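(* Let $p$ and $q$ be positive integers. For every graph $G$ the following statements are equivalent: (i) $G$ is hereditary $(p,q)$-clique-Helly; (ii) $G$ is $(p,q')$-clique-Helly for every integer $q'\geq q$; (iii) $G$ is strong $(p,q)$-clique-Helly; (iv) every family of $p+1$ maximal cliques of $G$ is strong $(p,q)$-Helly; (v) $\varPhi_q(G)$ is hereditary $p$-clique-Helly; (vi) a clique-matrix $C(G)$ of $G$ contains no incidence matrix of $\mathcal J_{p+1,q,s}$ as a submatrix for any $s\in\{0,\ldots,q-1\}$; (vii) for each $s\in\{0,\ldots,q-1\}$, each subset $U$ of $V(G)$ with $|U|=(p+1)(q-s)+s$, and each $p+1$ pairwise disjoint $(q-s)$-subsets $T_1,\ldots,T_{p+1}$ of $U$ such that $U-T_1,\ldots,U-T_{p+1}$ are cliques of $G$, there is some $i\in\{1,\ldots,p+1\}$ and some $v\in T_i$ such that $v$ is adjacent to every vertex of $G$ (other than $v$) that is complete to $U-T_i$; (viii) $G$ contains no induced subgraph isomorphic to a $(p+1,q,s)$-ocular for any $s\in\{0,\ldots,q-1\}$.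
   Context: Graphs are finite, simple and undirected. A clique is a set of pairwise adjacent vertices; maximal means inclusion-wise maximal. A vertex $v$ is complete (resp. anticomplete) to a set $W$ if $v$ is adjacent (resp. nonadjacent) to every vertex of $W-\{v\}$. The core of a family of sets is the intersection of its members. A family is $(p,q)$-intersecting if every nonempty subfamily of at most $p$ members has core of cardinality at least $q$, and has the $(p,q)$-Helly property if every nonempty $(p,q)$-intersecting subfamily has core of cardinality at least $q$. A family $\mathcal F$ of sets is strong $(p,q)$-Helly if for every nonempty $(p,q)$-intersecting subfamily $\mathcal F'$ there is a nonempty subfamily of at most $p$ members of $\mathcal F'$ with the same core as $\mathcal F'$. A graph is $(p,q)$-clique-Helly if the family of its maximal cliques has the $(p,q)$-Helly property ($p$-clique-Helly means $(p,1)$-clique-Helly), hereditary $(p,q)$-clique-Helly (resp. hereditary $p$-clique-Helly) if every induced subgraph is $(p,q)$-clique-Helly (resp. $p$-clique-Helly), and strong $(p,q)$-clique-Helly if the family of its maximal cliques is strong $(p,q)$-Helly. $\varPhi_q(G)$ is the graph whose vertices are the cliques of cardinality $q$ of $G$, two being adjacent iff they are contained in a common clique of $G$. A clique-matrix $C(G)$ is a $(0,1)$-matrix with one row per maximal clique and one column per vertex of $G$, with a $1$ exactly when the clique contains the vertex. For $s\in\{0,\ldots,q-1\}$, $\mathcal J_{p+1,q,s}$ is the hypergraph with vertex set $V$ of cardinality $(p+1)(q-s)+s$ and the $p+1$ edges $V-T_1,\ldots,V-T_{p+1}$, where $T_1,\ldots,T_{p+1}$ are pairwise disjoint $(q-s)$-subsets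 of $V$; its incidence matrix has one row per edge and one column per vertex. For $s\in\{0,\ldots,q-1\}$, a $(p+1,q,s)$-ocular is a graph whose vertex set is the union of disjoint sets $U$ and $W$, where $|U|=(p+1)(q-s)+s$, and $T_1,\ldots,T_{p+1}$ are pairwise disjoint $(q-s)$-subsets of $U$, such that either ($\alpha_1$) $p=1$, $W=\emptyset$, and for each $i\in\{1,2\}$, $U-T_i$ is a clique but $(U-T_i)\cup\{v_i\}$ is not a clique for each $v_i\in T_i$; or ($\alpha_2$) $p\ge 2$, $W=\{w_1,\ldots,w_{p+1}\}$, $U$ is a clique, and for each $i$, $w_i$ is complete to $U-T_i$ and anticomplete to $T_i$ (the graph induced by $W$ is arbitrary). *)

(* Defs.v *)
From HB Require Import structures.
From mathcomp Require Import all_boot all_algebra.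

Set Implicit Arguments.
Unset Strict Implicit.
Unset Printing Implicit Defensive.

(** * Families of sets *)

Section Families.
Variable V : finType.
Implicit Types F : {set {set V}}.

(* Only ever used on nonempty families; on [set0] the value is [setT]. *)
Definition core F : {set V} := \bigcap_(A in F) A.

Definition intersecting (p q : nat) F : Prop :=
  forall F', F' \subset F -> F' != set0 -> #|F'| <= p -> q <= #|core F'|.

Definition helly (p q : nat) F : Prop :=
  forall F', F' \subset F -> F' != set0 -> intersecting p q F' ->
  q <= #|core F'|.

Definition strong_helly (p q : nat) F : Prop :=
  forall F', F' \subset F -> F' != set0 -> intersecting p q F' ->
  exists F'', [/\ F'' \subset F', F'' != set0, #|F''| <= p
                & core F'' = core F'].

(* [T] lists [k] pairwise disjoint [t]-subsets of [U]. *)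
Definition disjoint_subsets (k t : nat) (U : {set V}) (T : 'I_k -> {set V})
    : Prop :=
  [/\ forall i, T i \subset U,
      forall i, #|T i| = t
    & forall i j, i != j -> [disjoint T i & T j]].

(* The orders of the rows and of the columns are arbitrary. *)
Definition incidence_matrix (E : {set {set V}}) (m n : nat) (M : 'M[nat]_(m, n))
    : Prop :=
  exists (r : 'I_m -> {set V}) (c : 'I_n -> V),
    [/\ injective r, [set r i | i : 'I_m] = E, bijective c
      & forall i j, M i j = (c j \in r i)].

(* [E] is the edge set of a copy of J_{p+1,q,s} whose vertex set is the whole
   type [V]. *)
Definition hypergraph_J (p q s : nat) (E : {set {set V}}) : Prop :=
  #|V| = p.+1 * (q - s) + s /\
  exists T : 'I_p.+1 -> {set V},
    disjoint_subsets (q - s) [set: V] T /\ E = [set ~: T i | i : 'I_p.+1].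

End Families.

Definition submatrix (m n m' n' : nat) (M : 'M[nat]_(m', n'))
    (C : 'M[nat]_(m, n)) : Prop :=
  exists (f : 'I_m' -> 'I_m) (g : 'I_n' -> 'I_n),
    [/\ {homo f : i j / i < j}, {homo g : i j / i < j} & M = mxsub f g C].

Definition contains_J_submatrix (p q s m n : nat) (C : 'M[nat]_(m, n)) : Prop :=
  exists (V : finType) (E : {set {set V}}) (m' n' : nat)
         (M : 'M[nat]_(m', n')),
    [/\ hypergraph_J p q s E, incidence_matrix E M & submatrix M C].

(** * Graphs *)

Record sgraph := SGraph {
  vertex :> finType;
  adj : rel vertex;
  adj_sym : symmetric adj;
  adj_irrefl : irreflexive adj }.

Section Graphs.
Variable G : sgraph.
Implicit Types (Q W : {set G}) (v : G).

Definition clique Q : bool :=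
  [forall x in Q, forall y in Q, (x != y) ==> adj x y].

Definition maxcliques : {set {set G}} := [set Q | maxset clique Q].

Definition complete v W : bool := [forall w in W :\ v, adj v w].

Definition anticomplete v W : bool := [forall w in W :\ v, ~~ adj v w].

Section Induced.
Variable S : {set G}.
Definition induced_adj : rel {x : G | x \in S} := fun x y => adj (val x) (val y).
Lemma induced_adj_sym : symmetric induced_adj.
Proof. by move=> x y; apply: adj_sym. Qed.
Lemma induced_adj_irrefl : irreflexive induced_adj.
Proof. by move=> x; apply: adj_irrefl. Qed.
Definition induced : sgraph := SGraph induced_adj_sym induced_adj_irrefl.
End Induced.

Section Phi.
Variable q : nat.
Definition Phi_vertex := {Q : {set G} | clique Q && (#|Q| == q)}.
Definition Phi_adj : rel Phi_vertex := fun A B =>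
  (A != B) &&
  [exists K : {set G}, [&& clique K, val A \subset K & val B \subset K]].
Lemma Phi_adj_sym : symmetric Phi_adj.
Proof.
move=> A B; rewrite /Phi_adj eq_sym; congr (_ && _).
by apply: eq_existsb => K; rewrite [(val A \subset K) && _]andbC.
Qed.
Lemma Phi_adj_irrefl : irreflexive Phi_adj.
Proof. by move=> A; rewrite /Phi_adj eqxx. Qed.
Definition Phi : sgraph := SGraph Phi_adj_sym Phi_adj_irrefl.
End Phi.

Definition clique_helly (p q : nat) : Prop := helly p q maxcliques.

Definition strong_clique_helly (p q : nat) : Prop :=
  strong_helly p q maxcliques.

Definition clique_matrix (m n : nat) (C : 'M[nat]_(m, n)) : Prop :=
  incidence_matrix maxcliques C.

Lemma clique_matrix_exists :
  exists C : 'M[nat]_(#|maxcliques|, #|G|), clique_matrix C.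
Proof.
pose r (i : 'I_#|maxcliques|) : {set G} := enum_val i.
pose c (j : 'I_#|G|) : G := enum_val j.
exists (\matrix_(i, j) ((c j \in r i) : nat))%R.
exists r, c; split.
- exact: enum_val_inj.
- apply/setP=> A; apply/imsetP/idP => [[i _ ->]|AF]; first exact: enum_valP.
  by exists (enum_rank_in AF A); rewrite /r ?enum_rankK_in.
- exact: enum_val_bij.
- by move=> i j; rewrite mxE.
Qed.

(* [G] itself is a (p+1,q,s)-ocular, with vertex set [U :|: W]. *)
Definition ocular (p q s : nat) : Prop :=
  exists (U W : {set G}) (T : 'I_p.+1 -> {set G}),
    [/\ U :|: W = [set: G], [disjoint U & W],
        #|U| = p.+1 * (q - s) + s, disjoint_subsets (q - s) U T
      & [/\ p = 1, W = set0
          & forall i, clique (U :\: T i) /\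
                      forall v, v \in T i -> ~~ clique (v |: (U :\: T i))]
        \/
        [/\ 2 <= p, clique U
          & exists w : 'I_p.+1 -> G,
              [/\ injective w, W = [set w i | i : 'I_p.+1]
                & forall i, complete (w i) (U :\: T i) /\
                            anticomplete (w i) (T i)]]].

End Graphs.

Definition hereditary_clique_helly (G : sgraph) (p q : nat) : Prop :=
  forall S : {set G}, clique_helly (induced S) p q.

Definition isomorphic (G H : sgraph) : Prop :=
  exists f : G -> H, bijective f /\ forall x y, adj (f x) (f y) = adj x y.

Definition contains_induced_ocular (G : sgraph) (p q s : nat) : Prop :=
  exists (H : sgraph) (S : {set G}),
    ocular H p q s /\ isomorphic (induced S) H.

(* Main.v *)
Require Import Defs.
From mathcomp Require Import all_boot all_algebra.
From mathcomp Require Import zify.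

(** All eight conditions say that there are no [p+1] maximal cliques
    [Q_0, ..., Q_p] such that, for every [i], the intersection [O_i] of the other
    [p] cliques has at least [q] elements and is not contained in [Q_i].

    - A strong Helly failure, shrunk to a minimal subfamily with the same core,
      contains such a family; conversely such a family is (p,q')-intersecting for
      [q' = min #|O_i|], but its core has fewer than [q'] elements.
    - Keeping the right number of elements of each [O_i :\: Q_i] and of the common
      part gives the incidence matrix of J_{p+1,q,s}.
    - Maximality of [Q_i] yields [w_i] in [Q_i] nonadjacent to a vertex of [O_i].
      If [p >= 2], the union of the [O_i] is a clique, and cutting each [O_i] down
      to the non-neighbours of [w_i] gives an ocular. If [p = 1], one needs equally
      large parts of [Q_0 :\: Q_1] and [Q_1 :\: Q_0] in which every vertex has a
      non-neighbour in the other part; these are built greedily.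
    - Replacing each [Q_i] by the set of its [q]-subsets translates the
      configuration for [(p, q)] in [G] into the one for [(p, 1)] in [Phi G q].

    The [Q_i] may be replaced by arbitrary cliques if the noninclusion is
    strengthened to: [Q_i :|: O_i] is not a clique. In that form the configuration
    passes from induced subgraphs to [G]. *)

Set Implicit Arguments.
Unset Strict Implicit.
Unset Printing Implicit Defensive.

(** * Finite sets: subsets of given size, sizes of unions *)

Lemma exists_subset_card (V : finType) (A : {set V}) (k : nat) :
  k <= #|A| -> exists2 B : {set V}, B \subset A & #|B| = k.
Proof.
move=> lekA; exists [set x in take k (enum A)].
  by apply/subsetP=> x; rewrite inE => /mem_take; rewrite mem_enum.
rewrite cardsE; have /card_uniqP -> := take_uniq k (enum_uniq A).
by rewrite size_takel // -cardE.
Qed.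

Lemma exists_notin (I : finType) (A : {set I}) :
  #|A| < #|I| -> exists i, i \notin A.
Proof.
move=> ltA; have [i] : exists i, i \in ~: A.
  by apply/card_gt0P; rewrite cardsCs setCK subn_gt0.
by rewrite inE; exists i.
Qed.

Lemma exists_neq (p : nat) (i : 'I_p.+1) : 0 < p -> exists j, j != i.
Proof.
move=> p_gt0; have [|j] := @exists_notin _ [set i]; first by rewrite cards1 card_ord.
by rewrite inE; exists j.
Qed.

Lemma leq_card_bigcup (V I : finType) (P : pred I) (T : I -> {set V}) (t : nat) :
  (forall i, P i -> #|T i| <= t) -> #|\bigcup_(i | P i) T i| <= #|P| * t.
Proof.
move=> leT; rewrite -sum_nat_const.
apply: (@leq_trans (\sum_(i | P i) #|T i|)); last exact: leq_sum.
elim/big_rec2: _ => [|i m A _ leA]; first by rewrite cards0.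
by rewrite (leq_trans _ (leq_add (leqnn _) leA)) // leq_card_setU.
Qed.

Lemma card_bigcup_disjoint (V I : finType) (T : I -> {set V}) (t : nat) :
  (forall i, #|T i| = t) -> (forall i j, i != j -> [disjoint T i & T j]) ->
  #|\bigcup_i T i| = #|I| * t.
Proof.
move=> cT dT; rewrite -sum1_card (partition_disjoint_bigcup _ _ dT) -sum_nat_const.
by apply: eq_bigr => i _; rewrite sum1_card cT.
Qed.

(** * Families of sets *)

Section Others.
Variables (V I : finType).
Implicit Types (A B : I -> {set V}) (i j : I).

Definition others A i : {set V} := \bigcap_(j | j != i) A j.

Lemma othersP A i x :
  reflect (forall j, j != i -> x \in A j) (x \in others A i).
Proof. exact: bigcapP. Qed.

Lemma othersS A B i :
  (forall j, A j \subset B j) -> others A i \subset others B i.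
Proof.
move=> sAB; apply/subsetP=> x /othersP xA; apply/othersP=> j ji.
by rewrite (subsetP (sAB j)) ?xA.
Qed.

(** A point of [others A i] outside [A i] lies in every other [A j], so it separates [A i] from
    [A j]. *)
Lemma others_inj A : (forall i, ~~ (others A i \subset A i)) -> injective A.
Proof.
move=> nA i j eqA; apply/eqP; apply: contraT => neq_ij.
have /subsetPn[x /othersP xA] := nA i.
by rewrite eqA xA // eq_sym.
Qed.

(* [s] is as large as the common part allows while staying below [q]. *)
Lemma select_J A q :
  0 < q -> (forall i, ~~ (others A i \subset A i)) ->
  (forall i, q <= #|others A i|) ->
  exists s (U : {set V}) (T : I -> {set V}),
    [/\ s < q, #|U| = #|I| * (q - s) + s,
        [/\ forall i, T i \subset U, forall i, #|T i| = q - s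
          & forall i j, i != j -> [disjoint T i & T j]],
        U \subset (\bigcap_i A i) :|: \bigcup_i others A i
      & forall i, A i :&: U = U :\: T i].
Proof.
move=> q_gt0 nA leA; pose C := \bigcap_i A i; pose D i := others A i :\: A i.
(* [t] is the future [q - s]: then [s = q - t] is the minimum of [q - 1] and [#|C|]. *)
pose t := maxn 1 (q - #|C|).
have leD i : t <= #|D i|.
  rewrite geq_max; apply/andP; split.
    have /subsetPn[x xo xA] := nA i.
    by apply/card_gt0P; exists x; rewrite inE xA.
  (* The part of [others A i] inside [A i] is contained in [C], so at least [q - #|C|] elements
     remain in [D i]. *)
  rewrite leq_subLR (leq_trans (leA i)) // -(cardsID (A i)) leq_add2r.
  apply: subset_leq_card; apply/subsetP=> x /setIP[/othersP xo xi].
  by apply/bigcapP=> j _; have [->|] := eqVneq j i => //; apply: xo.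
have [T /= sTD cT] : exists2 T : I -> {set V},
    forall i, T i \subset D i & forall i, #|T i| = t.
  have ex i : exists2 B : {set V}, B \subset D i & #|B| = t.
    exact: exists_subset_card.
  exact: fin_all_exists2 ex.
have [S sSC cS] : exists2 S : {set V}, S \subset C & #|S| = q - t.
  apply: exists_subset_card; rewrite /t; lia.
have dT i j : i != j -> [disjoint T i & T j].
  move=> ij; rewrite disjoint_subset; apply/subsetP=> x xi; rewrite inE.
  apply/negP=> xj; move: (subsetP (sTD i) x xi) (subsetP (sTD j) x xj).
  rewrite !inE => /andP[_ /othersP xo] /andP[/negP[]].
  by rewrite xo // eq_sym.
have mem_T i x : x \in T i -> x \notin A i.
  by move=> /(subsetP (sTD i)); rewrite inE => /andP[].
have T_other i j x : x \in T i -> j != i -> x \in A j.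
  by move=> /(subsetP (sTD i)); rewrite inE => /andP[_ /othersP xo] /xo.
have S_in i x : x \in S -> x \in A i.
  by move=> /(subsetP sSC)/bigcapP->.
exists (q - t), (S :|: \bigcup_i T i), T; split.
- rewrite /t; lia.
- rewrite cardsU disjoint_setI0 ?cards0 ?subn0.
    rewrite cS (card_bigcup_disjoint cT dT) addnC subKn //.
    rewrite /t; lia.
  rewrite disjoint_subset; apply/subsetP=> x xS; rewrite inE.
  apply/bigcupP=> -[i _ /mem_T]; by rewrite S_in.
- split=> // i.
    by rewrite (subset_trans _ (subsetUr _ _)) // (bigcup_sup i).
  rewrite cT subKn // /t; lia.
- rewrite setUSS //; apply/bigcupsP=> i _; apply: (subset_trans (sTD i)).
  by rewrite (subset_trans (subsetDl _ _)) // (bigcup_sup i).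
move=> i; apply/setP=> x; rewrite !inE andbC.
have [xS|] /= := boolP (x \in S).
  rewrite andbT S_in //; apply/esym/negP=> /mem_T; by rewrite S_in.
move=> _; have [/bigcupP[j _ xj]|] := boolP (x \in \bigcup_i T i); last by rewrite !andbF.
rewrite !andbT; have [xi|] := boolP (x \in T i); first exact/negbTE/mem_T.
by move=> xi; apply: (T_other j); rewrite //; apply: contraNneq xi => ->.
Qed.

End Others.

(** The intersection contains [U] minus the sets [T j] with [j != i]; these remove at most
    [(#|I| - 1) * t] elements. *)
Lemma card_others_setD (V I : finType) (s t : nat) (U : {set V})
    (T : I -> {set V}) (i : I) :
  (forall j, #|T j| = t) -> #|U| = #|I| * t + s ->
  t + s <= #|others (fun j => U :\: T j) i|.
Proof.
move=> cT cU; set X := \bigcup_(j | j != i) T j.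
have leX : #|X| <= #|I|.-1 * t.
  rewrite -(cardC1 i); apply: leq_card_bigcup => j _; by rewrite cT.
apply: (@leq_trans #|U :\: X|).
  have I_gt0 : 0 < #|I| by apply/card_gt0P; exists i.
  have := cardsID X U; have := subset_leq_card (subsetIr U X).
  rewrite cU; move: I_gt0 leX; case: #|I| => // k _ /=; rewrite mulSn; lia.
apply: subset_leq_card; apply/subsetP=> x /setDP[xU xX]; apply/othersP=> j ji.
by rewrite inE xU andbT; apply: contra xX => xT; apply/bigcupP; exists j.
Qed.

(* Greedy augmentation: if the partner of a new [x] is already in [B] and the
   partner of a new [y] is already in [A], then [x] and [y] can be added. *)
Lemma mutual_cover (V : finType) (R : rel V) (X Y : {set V}) (t : nat) :
  (forall x, x \in X -> exists2 y, y \in Y & R x y) ->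
  (forall y, y \in Y -> exists2 x, x \in X & R x y) ->
  t <= #|X| -> t <= #|Y| ->
  exists A B : {set V},
    [/\ A \subset X, B \subset Y, #|A| = t, #|B| = t
      & (forall x, x \in A -> exists2 y, y \in B & R x y) /\
        (forall y, y \in B -> exists2 x, x \in A & R x y)].
Proof.
move=> RX RY; elim: t => [_ _|t IHt ltX ltY].
  exists set0, set0; rewrite !sub0set !cards0; split=> //.
  by split=> z; rewrite inE.
have [A [B [sAX sBY cA cB [cov_A cov_B]]]] := IHt (ltnW ltX) (ltnW ltY).
have extend x y : x \in X -> y \in Y -> x \notin A -> y \notin B ->
  (exists2 y', y' \in y |: B & R x y') -> (exists2 x', x' \in x |: A & R x' y) ->
  exists A B : {set V},
    [/\ A \subset X, B \subset Y, #|A| = t.+1, #|B| = t.+1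
      & (forall x, x \in A -> exists2 y, y \in B & R x y) /\
        (forall y, y \in B -> exists2 x, x \in A & R x y)].
  move=> xX yY xA yB Rx Ry; exists (x |: A), (y |: B).
  rewrite !subUset !sub1set xX yY sAX sBY !cardsU1 xA yB cA cB; split=> //.
  split=> z /setU1P[->|] //.
    by move=> /cov_A[u uB Ru]; exists u; rewrite // inE uB orbT.
  by move=> /cov_B[u uA Ru]; exists u; rewrite // inE uA orbT.
have [x xX xA] : exists2 x, x \in X & x \notin A.
  by apply/subsetPn; apply: contraTN ltX => /subset_leq_card; rewrite cA -leqNgt.
have [y yY yB] : exists2 y, y \in Y & y \notin B.
  by apply/subsetPn; apply: contraTN ltY => /subset_leq_card; rewrite cB -leqNgt.
have [[y' y'Y Rx] [x' x'X Ry]] := (RX _ xX, RY _ yY).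
(* If the partner of [x] or of [y] is still free, the new element and its partner are added together
   and serve each other. *)
have [y'B|y'B] := boolP (y' \in B); last first.
  by apply: (extend x y'); rewrite //; [exists y'|exists x]; rewrite ?setU11.
have [x'A|x'A] := boolP (x' \in A); last first.
  by apply: (extend x' y); rewrite //; [exists y|exists x']; rewrite ?setU11.
by apply: (extend x y); rewrite //; [exists y'|exists x'];
  rewrite // inE ?y'B ?x'A orbT.
Qed.

(** * Helly properties of families of [p + 1] sets *)

Section Families.
Variables (V : finType) (p : nat).
Implicit Types (Q : 'I_p.+1 -> {set V}) (F : {set {set V}}).

Lemma coreS F F' : F' \subset F -> core F \subset core F'.
Proof.
move=> sF; apply/bigcapsP=> A AF'; exact: (bigcap_inf A (subsetP sF A AF')).
Qed.

Lemma core_imset Q : core [set Q i | i : 'I_p.+1] = \bigcap_i Q i.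
Proof.
apply/setP=> x; apply/bigcapP/bigcapP => [xQ i _|xQ A /imsetP[i _ ->]].
  by rewrite xQ ?imset_f.
exact: xQ.
Qed.

(** At most [p] sets cannot exhaust [p + 1] distinct ones: some [Q i] is left out, and every member
    of [F] is one of the others. *)
Lemma missing_member Q F :
  injective Q -> F \subset [set Q i | i : 'I_p.+1] -> #|F| <= p ->
  exists2 i, Q i \notin F & others Q i \subset core F.
Proof.
move=> injQ sF cF; have [i Qi] : exists i, i \notin Q @^-1: F.
  apply: exists_notin; rewrite card_ord ltnS (leq_trans _ cF) //.
  rewrite -(card_imset _ injQ) subset_leq_card //.
  by apply/subsetP=> A /imsetP[j]; rewrite inE => QF ->.
rewrite inE in Qi; exists i => //; apply/subsetP=> x /othersP xo.
apply/bigcapP=> A AF; have /imsetP[j _ eqA] := subsetP sF A AF.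
by rewrite eqA xo //; apply: contraNneq Qi => <-; rewrite -eqA.
Qed.

Lemma intersecting_imset Q q :
  injective Q -> (forall i, q <= #|others Q i|) ->
  intersecting p q [set Q i | i : 'I_p.+1].
Proof.
move=> injQ leQ F sF _ /(missing_member injQ sF)[i _ /subset_leq_card].
exact: leq_trans.
Qed.

(** The whole family is intersecting, but the core of any [p] members contains some [others Q i],
    hence a point outside [Q i]. *)
Lemma not_strong_helly_imset Q q :
  (forall i, ~~ (others Q i \subset Q i)) -> (forall i, q <= #|others Q i|) ->
  ~ strong_helly p q [set Q i | i : 'I_p.+1].
Proof.
move=> nQ leQ sh; have injQ := others_inj nQ.
have ne : [set Q i | i : 'I_p.+1] != set0.
  by apply/set0Pn; exists (Q ord0); rewrite imset_f.
have [F [sF _ cF eqF]] := sh _ (subxx _) ne (intersecting_imset injQ leQ).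
have [i _ sub] := missing_member injQ sF cF.
case/subsetPn: (nQ i) => x /(subsetP sub); rewrite eqF core_imset.
by move=> /bigcapP->.
Qed.

Lemma not_helly_imset Q q F :
  (forall i, ~~ (others Q i \subset Q i)) -> (forall i, q <= #|others Q i|) ->
  (forall i, Q i \in F) -> #|\bigcap_i Q i| < q -> ~ helly p q F.
Proof.
move=> nQ leQ QF ltq h; have injQ := others_inj nQ.
move: ltq; rewrite ltnNge -core_imset => /negP; apply.
apply: h; last exact: intersecting_imset.
  by apply/subsetP=> A /imsetP[i _ ->].
by apply/set0Pn; exists (Q ord0); rewrite imset_f.
Qed.

(** Take for [q'] the least [#|others Q i|]: the intersection of all [Q i] is a proper subset of the
    minimizer, hence smaller than [q']. *)
Lemma not_helly_some Q q F :
  (forall i, ~~ (others Q i \subset Q i)) -> (forall i, q <= #|others Q i|) ->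
  (forall i, Q i \in F) -> exists2 q', q <= q' & ~ helly p q' F.
Proof.
move=> nQ leQ QF.
case: (arg_minnP (fun i => #|others Q i|) (isT : xpredT (ord0 : 'I_p.+1))) => i _ min_i.
exists #|others Q i|; first exact: leQ.
apply: (not_helly_imset nQ) => // [j|]; first exact: min_i.
apply: proper_card; rewrite properE; apply/andP; split.
  by apply/subsetP=> x /bigcapP xQ; apply/othersP=> j _; apply: xQ.
apply: contra (nQ i) => /subset_trans; apply; exact: bigcap_inf.
Qed.

Lemma no_obstruction_strong_helly F q :
  (forall Q, (forall i, [/\ Q i \in F, ~~ (others Q i \subset Q i)
                         & q <= #|others Q i|]) -> False) ->
  0 < p -> strong_helly p q F.
Proof.
move=> noQ p_gt0 F' sF' ne int.
pose P (F0 : {set {set V}}) := (F0 != set0) && (core F0 == core F').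
have PF' : P F' by rewrite /P ne eqxx.
have [F0 /minsetP[/andP[ne0 /eqP eqF0] minF0] sF0] := minset_exists PF'.
exists F0; split=> //; rewrite leqNgt; apply/negP=> ltp.
have [F1 sF1 cF1] := exists_subset_card ltp.
pose Q (i : 'I_p.+1) := enum_val (cast_ord (esym cF1) i).
have injQ : injective Q by move=> i j /enum_val_inj/cast_ord_inj.
have QF1 i : Q i \in F1 by apply: enum_valP.
have QF0 i : Q i \in F0 by apply: (subsetP sF1).
have core_oth i : core (F1 :\ Q i) \subset others Q i.
  apply/subsetP=> x /bigcapP xF; apply/othersP=> j ji.
  by apply: xF; rewrite !inE (inj_eq injQ) ji QF1.
have cF1D i : #|F1 :\ Q i| = p by move: (cardsD1 (Q i) F1); rewrite QF1 cF1 => -[].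
apply: (noQ Q) => i; split.
- by rewrite (subsetP sF') // (subsetP sF0).
(* If [others Q i] were inside [Q i], removing [Q i] would keep the core, against minimality;
   [0 < p] keeps the remaining family nonempty. *)
- apply/negP=> sub; have := minF0 (F0 :\ Q i) _ (subD1set _ _).
  have neD : F0 :\ Q i != set0.
    rewrite -card_gt0 (leq_trans p_gt0) // -(cF1D i).
    by apply: subset_leq_card; apply: setSD.
  rewrite /P neD -eqF0 eqEsubset [_ \subset core (_ :\ _)]coreS ?subD1set // andbT.
  move=> /(_ _)/setP/(_ (Q i)); rewrite !inE eqxx QF0 /= => H; suff: false by [].
  apply: H; apply/bigcapsP=> A AF0; have [->|neA] := eqVneq A (Q i).
    apply: subset_trans sub; apply: subset_trans (core_oth i).
    by apply: coreS; apply: setSD.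
  by apply: bigcap_inf; rewrite !inE neA.
have ltF1 : q <= #|core (F1 :\ Q i)|.
  apply: int; last by rewrite cF1D.
    exact: subset_trans (subD1set _ _) (subset_trans sF1 sF0).
  by rewrite -card_gt0 cF1D.
exact: leq_trans ltF1 (subset_leq_card (core_oth i)).
Qed.

End Families.

(** * Cliques *)

Section Cliques.
Variable G : sgraph.
Implicit Types (A B K Q : {set G}) (x y : G).

Lemma cliqueP A : reflect {in A &, forall x y, x != y -> adj x y} (clique A).
Proof.
apply: (iffP forall_inP) => [cA x y xA yA|cA x xA].
  by move/forall_inP: (cA x xA) => /(_ y yA)/implyP.
by apply/forall_inP=> y yA; apply/implyP; apply: cA.
Qed.

Lemma cliqueS A B : A \subset B -> clique B -> clique A.
Proof.
move=> /subsetP sAB /cliqueP cB; apply/cliqueP=> x y xA yA.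
by apply: cB; apply: sAB.
Qed.

Lemma cliqueN A x y : x \in A -> y \in A -> x != y -> ~~ adj x y -> ~~ clique A.
Proof. by move=> xA yA xy; apply: contra => /cliqueP->. Qed.

Lemma clique_setU1 A x : clique A -> complete x A -> clique (x |: A).
Proof.
move=> /cliqueP cA /forall_inP cx; apply/cliqueP=> y z.
move=> /setU1P[->|yA] /setU1P[->|zA] yz; first by rewrite eqxx in yz.
- by apply: cx; rewrite !inE eq_sym yz.
- by rewrite adj_sym; apply: cx; rewrite !inE yz.
- exact: cA.
Qed.

Lemma maxclique_clique Q : Q \in maxcliques G -> clique Q.
Proof. by rewrite inE => /maxsetp. Qed.

Lemma maxclique_exists K :
  clique K -> exists2 Q, Q \in maxcliques G & K \subset Q.
Proof. by move=> /maxset_exists[Q maxQ sKQ]; exists Q; rewrite ?inE. Qed.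

Lemma maxclique_subset Q K :
  Q \in maxcliques G -> clique K -> Q \subset K -> K = Q.
Proof. by rewrite inE => /maxsetP[_]; apply. Qed.

Lemma maxclique_notin Q x :
  Q \in maxcliques G -> x \notin Q ->
  exists y, [/\ y \in Q, x != y & ~~ adj x y].
Proof.
move=> maxQ xQ.
have [/forallP cx|/forallPn[y]] := boolP (complete x Q).
  have := maxclique_subset maxQ _ (subsetUr [set x] Q).
  rewrite clique_setU1 ?maxclique_clique //; last exact/forallP.
  by move=> /(_ isT) eqQ; rewrite -eqQ setU11 in xQ.
by rewrite !inE negb_imply => /andP[/andP[yx yQ] nxy]; exists y; rewrite eq_sym.
Qed.

End Cliques.

(** * Obstructions and their transfer along induced embeddings *)

Definition obstruction (p q : nat) (G : sgraph) : Prop :=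
  exists K : 'I_p.+1 -> {set G},
    forall i, [/\ clique (K i), ~~ clique (K i :|: others K i)
                & q <= #|others K i|].

(** Enlarging the cliques enlarges [others], and no clique containing [K i] can contain
    [others K i]. Conversely, if [Q i :|: others Q i] were a clique, maximality would make it equal
    to [Q i]. *)
Lemma obstructionP (p q : nat) (G : sgraph) :
  obstruction p q G <->
  exists Q : 'I_p.+1 -> {set G},
    forall i, [/\ Q i \in maxcliques G, ~~ (others Q i \subset Q i)
                & q <= #|others Q i|].
Proof.
split=> [[K obK]|[Q obQ]]; last first.
  exists Q => i; have [maxQ nQ leQ] := obQ i.
  split=> //; first exact: maxclique_clique.
  apply: contra nQ => cQ.
  by rewrite -(maxclique_subset maxQ cQ (subsetUl _ _)) subsetUr.
have [Q maxQ sKQ] : exists2 Q : 'I_p.+1 -> {set G},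
    forall i, Q i \in maxcliques G & forall i, K i \subset Q i.
  have ex i : exists2 Q, Q \in maxcliques G & K i \subset Q.
    by apply: maxclique_exists; have [] := obK i.
  exact: fin_all_exists2 ex.
exists Q => i; have [_ nK leK] := obK i; split=> //.
  apply: contra nK => sub; apply: cliqueS (maxclique_clique (maxQ i)).
  by rewrite subUset sKQ (subset_trans (othersS i sKQ) sub).
exact: leq_trans leK (subset_leq_card (othersS i sKQ)).
Qed.

Lemma obstruction_embed (p q : nat) (G H : sgraph) (h : H -> G) :
  injective h -> (forall x y, adj (h x) (h y) = adj x y) ->
  obstruction p q H -> obstruction p q G.
Proof.
move=> injh adjh [K obK]; exists (fun i => h @: K i) => i.
have [cK nK leK] := obK i.
have clique_h (A : {set H}) : clique (h @: A) = clique A.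
  apply/cliqueP/cliqueP => cA x y.
    move=> xA yA xy; rewrite -adjh; apply: cA; rewrite ?imset_f ?(inj_eq injh) //.
  move=> /imsetP[u uA ->] /imsetP[v vA ->]; rewrite (inj_eq injh) adjh; exact: cA.
have sub : h @: others K i \subset others (fun j => h @: K j) i.
  apply/subsetP=> _ /imsetP[x /othersP xK ->]; apply/othersP=> j ji.
  by rewrite imset_f ?xK.
split; first by rewrite clique_h.
  by apply: contra nK; rewrite -clique_h imsetU; apply: cliqueS; rewrite setUS.
by rewrite (leq_trans leK) // -(card_imset _ injh) subset_leq_card.
Qed.

Lemma obstruction_induced (p q : nat) (G : sgraph) (S : {set G}) :
  obstruction p q (induced S) -> obstruction p q G.
Proof.
by apply: (@obstruction_embed p q G (induced S) val) => //; apply: val_inj.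
Qed.

(** * Oculars *)

(* [ocular] relative to a vertex set [U :|: W] that need not be everything. *)
Definition ocular_on (G : sgraph) (p q s : nat) (U W : {set G})
    (T : 'I_p.+1 -> {set G}) : Prop :=
  [/\ [disjoint U & W], #|U| = p.+1 * (q - s) + s,
      disjoint_subsets (q - s) U T
    & [/\ p = 1, W = set0
        & forall i, clique (U :\: T i) /\
                    forall v, v \in T i -> ~~ clique (v |: (U :\: T i))]
      \/
      [/\ 2 <= p, clique U
        & exists w : 'I_p.+1 -> G,
            [/\ injective w, W = [set w i | i : 'I_p.+1]
              & forall i, complete (w i) (U :\: T i) /\
                          anticomplete (w i) (T i)]]].

(** [Q i] extends [U :\: T i], together with [w i] when [p >= 2]. Vertices of [T i] have a
    non-neighbour in [Q i], and each vertex outside [U] misses some [Q i], so only the [s] vertices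
    of [U] outside all [T i] can be common. *)
Lemma ocular_maxcliques (H : sgraph) (p q s : nat) :
  s < q -> ocular H p q s ->
  exists Q : 'I_p.+1 -> {set H},
    (forall i, [/\ Q i \in maxcliques H, ~~ (others Q i \subset Q i)
                 & q <= #|others Q i|]) /\ #|\bigcap_i Q i| < q.
Proof.
move=> ltsq [U [W [T [eqUW dUW cU [sTU cT dT] cases]]]].
have Tex i : exists x, x \in T i by apply/card_gt0P; rewrite cT subn_gt0.
have UW x : (x \in U) || (x \in W) by rewrite -in_setU eqUW inE.
have T_U i x : x \in T i -> x \in U by apply/subsetP.
have T_notin i j x : x \in T i -> j != i -> x \notin T j.
  by move=> xi ji; rewrite (disjointFl (dT _ _ ji)).
have [K [cK sK nK outK]] : exists K : 'I_p.+1 -> {set H},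
    [/\ forall i, clique (K i), forall i, U :\: T i \subset K i,
        forall i x, x \in T i -> ~~ clique (x |: K i)
      & forall x, x \notin U -> exists i, ~~ clique (x |: K i)].
  case: cases => [[_ W0 cl]|[p_ge2 clU [w [_ defW cw]]]].
    exists (fun i => U :\: T i); split=> // [i|i x|x]; try by have [? ?] := cl i; auto.
    by have := UW x; rewrite W0 inE orbF => ->.
  have nw i x : x \in T i -> x != w i -> ~~ adj (w i) x.
    by move=> xi xw; have [_ /forall_inP] := cw i; apply; rewrite !inE xw.
  have wU i : w i \notin U by rewrite (disjointFl dUW) // defW imset_f.
  have x_neq_w i x : x \in T i -> x != w i.
    by move=> /T_U xU; apply: contraTneq xU => ->.
  exists (fun i => w i |: (U :\: T i)); split=> [i|i|i x xi|x xU].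
  - by apply: clique_setU1; [apply: cliqueS clU; apply: subsetDl|have [] := cw i].
  - exact: subsetUr.
  - apply: (@cliqueN _ _ (w i) x); rewrite ?nw ?x_neq_w // ?inE ?eqxx ?orbT //.
    by rewrite eq_sym x_neq_w.
  have /imsetP[j _ ->] : x \in [set w i | i : 'I_p.+1].
    by have := UW x; rewrite (negbTE xU) defW.
  (* [w j] is nonadjacent to [y] in [T j], and [y] lies in [K i] for every [i != j]. *)
  have [i ij] := exists_neq j (ltnW p_ge2).
  have [y yj] := Tex j.
  exists i; apply: (@cliqueN _ _ (w j) y); rewrite ?nw ?x_neq_w // ?setU11 //.
    by rewrite !inE (T_notin j) // (T_U j) ?orbT.
  by rewrite eq_sym x_neq_w.
have [Q maxQ sKQ] : exists2 Q : 'I_p.+1 -> {set H},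
    forall i, Q i \in maxcliques H & forall i, K i \subset Q i.
  have ex i : exists2 Q, Q \in maxcliques H & K i \subset Q.
    exact: maxclique_exists.
  exact: fin_all_exists2 ex.
have outQ i x : ~~ clique (x |: K i) -> x \notin Q i.
  apply: contra => xi; apply: cliqueS (maxclique_clique (maxQ i)).
  by rewrite subUset sub1set xi sKQ.
have sUQ i : U :\: T i \subset Q i by apply: subset_trans (sKQ i).
have sub_oth i := othersS i sUQ.
exists Q; split=> [i|].
  split=> //.
    have [x xi] := Tex i; apply/subsetPn; exists x; last exact/outQ/nK.
    apply: (subsetP (sub_oth i)); apply/othersP=> j ji.
    by rewrite inE (T_notin i) ?(T_U i).
  rewrite (leq_trans _ (subset_leq_card (sub_oth i))) //.
  rewrite -(subnK (ltnW ltsq)); apply: card_others_setD => //.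
  by rewrite cU card_ord.
apply: (@leq_ltn_trans #|U :\: \bigcup_i T i|).
  apply: subset_leq_card; apply/subsetP=> x /bigcapP xQ; rewrite inE.
  apply/andP; split.
    apply/negP=> /bigcupP[i _ xi]; have := xQ i isT; apply/negP.
    exact/outQ/nK.
  apply: contraT => /outK[i /outQ]; by rewrite xQ.
rewrite cardsD (setIidPr _); last exact/bigcupsP.
by rewrite (card_bigcup_disjoint cT dT) cU card_ord addKn.
Qed.

Lemma ocular_obstruction (H : sgraph) (p q s : nat) :
  s < q -> ocular H p q s -> obstruction p q H.
Proof.
by move=> ltsq /(ocular_maxcliques ltsq)[Q [obQ _]]; apply/obstructionP; exists Q.
Qed.

Lemma ocular_not_helly (H : sgraph) (p q s : nat) :
  s < q -> ocular H p q s -> ~ clique_helly H p q.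
Proof.
move=> ltsq /(ocular_maxcliques ltsq)[Q [obQ ltQ]].
by apply: (not_helly_imset (Q := Q)) => // i; have [] := obQ i.
Qed.

Lemma ocular_induced (G : sgraph) (p q s : nat) (U W : {set G}) T :
  @ocular_on G p q s U W T -> ocular (induced (U :|: W)) p q s.
Proof.
set S := U :|: W; pose H := induced S.
pose h : H -> G := val.
pose pre (A : {set G}) : {set H} := h @^-1: A.
have injh : injective h by apply: val_inj.
have preK (A : {set G}) : A \subset S -> h @: pre A = A.
  move=> /subsetP sAS; apply/setP=> x; apply/imsetP/idP => [[y]|xA].
    by rewrite inE => yA ->.
  by exists (exist _ x (sAS x xA)); rewrite ?inE.
have card_pre (A : {set G}) : A \subset S -> #|pre A| = #|A|.
  by move=> sAS; rewrite -(card_imset _ injh) preK.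
have clique_pre (A : {set G}) : A \subset S -> clique (pre A) = clique A.
  move=> /subsetP sAS; apply/cliqueP/cliqueP => cA x y.
    move=> xA yA xy.
    have := cA (exist _ x (sAS x xA)) (exist _ y (sAS y yA)).
    by apply; rewrite ?inE // -(inj_eq injh).
  by rewrite !inE => xA yA xy; apply: cA; rewrite ?(inj_eq injh).
have sUS : U \subset S by apply: subsetUl.
have sDS i : U :\: T i \subset S by apply: subset_trans sUS; apply: subsetDl.
have preD (A B : {set G}) : pre (A :\: B) = pre A :\: pre B by apply: preimsetD.
have disj_pre (A B : {set G}) : [disjoint A & B] -> [disjoint pre A & pre B].
  by rewrite -!setI_eq0 => /eqP AB; rewrite -preimsetI AB preimset0.
move=> [dUW cU [sTU cT dT] cases].
exists (pre U), (pre W), (fun i => pre (T i)); split=> //.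
- by rewrite -preimsetU; apply/setP=> x; rewrite !inE; have := valP x; rewrite inE.
- exact: disj_pre.
- by rewrite card_pre.
- split=> [i|i|i j ij]; last exact/disj_pre/dT.
    exact: preimsetS.
  by rewrite card_pre // (subset_trans (sTU i)).
case: cases => [[p1 W0 cl]|[p_ge2 clU [w [injw defW cw]]]]; [left|right].
  split=> // [|i]; first by rewrite W0 /pre preimset0.
  have [cUT nUT] := cl i; rewrite -preD clique_pre //; split=> // v.
  rewrite inE => vT; have -> : v |: pre (U :\: T i) = pre (h v |: (U :\: T i)).
    by apply/setP=> x; rewrite !inE (inj_eq injh).
  rewrite clique_pre; first exact: nUT.
  by rewrite subUset sub1set sDS andbT; apply: (valP v).
have wS i : w i \in S by rewrite inE defW imset_f ?orbT.
split=> //; first by rewrite clique_pre.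
exists (fun i => exist _ (w i) (wS i)); split.
- by move=> i j [/injw].
- apply/setP=> x; rewrite inE defW; apply/imsetP/imsetP => -[i _ eqx]; exists i => //.
    exact: val_inj.
  by rewrite eqx.
move=> i; have [/forall_inP com /forall_inP acom] := cw i.
rewrite -preD; split; apply/forall_inP=> x; rewrite !inE => /andP[xw xU].
  by apply: com; rewrite !inE xU andbT -[w i]/(h (exist _ (w i) (wS i))) (inj_eq injh).
by apply: acom; rewrite !inE xU andbT -[w i]/(h (exist _ (w i) (wS i))) (inj_eq injh).
Qed.

(** With two cliques, [others] merely swaps them. [mutual_cover], applied to nonadjacency between
    the two differences, yields the sets [T i]; common vertices complete [U]. *)
Lemma obstruction_ocular_p1 (G : sgraph) (q : nat) :
  0 < q -> obstruction 1 q G ->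
  exists s (U W : {set G}) T, s < q /\ @ocular_on G 1 q s U W T.
Proof.
move=> q_gt0 /obstructionP[Q obQ]; pose i1 : 'I_2 := ord_max.
have ord2 (i : 'I_2) : i = ord0 \/ i = i1.
  by case: i => -[|[|//]] lti; [left|right]; apply: val_inj.
have maxQ i : Q i \in maxcliques G by have [] := obQ i.
have leQ i : q <= #|Q i|.
  have [j ji] := exists_neq i (ltn0Sn 0).
  have [_ _ /leq_trans] := obQ j; apply; apply: subset_leq_card.
  by apply: bigcap_inf; rewrite eq_sym.
have neD i j : i != j -> 0 < #|Q j :\: Q i|.
  move=> ij; have [_ /subsetPn[x /othersP xo xi] _] := obQ i.
  by apply/card_gt0P; exists x; rewrite inE xi xo // eq_sym.
set X := Q i1 :\: Q ord0; set Y := Q ord0 :\: Q i1.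
pose t := maxn 1 (q - #|Q ord0 :&: Q i1|).
have leX : t <= #|X|.
  rewrite geq_max neD // leq_subLR setIC.
  by rewrite (leq_trans (leQ i1)) // -(cardsID (Q ord0) (Q i1)).
have leY : t <= #|Y|.
  by rewrite geq_max neD // leq_subLR cardsID leQ.
pose R : rel G := fun x y => ~~ adj x y.
have [||A [B [sAX sBY cA cB [covA covB]]]] := mutual_cover (R := R) _ _ leX leY.
(* Maximality of [Q ord0] gives [x] a non-neighbour there; it is outside [Q i1], a clique containing
   [x]. *)
- move=> x /setDP[x1 x0]; have [y [y0 xy nxy]] := maxclique_notin (maxQ _) x0.
  exists y => //; rewrite inE y0 andbT; apply: contra nxy => y1.
  by have /cliqueP-> := maxclique_clique (maxQ i1).
- move=> y /setDP[y0 y1]; have [x [x1 yx nyx]] := maxclique_notin (maxQ _) y1.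
  exists x; rewrite /R 1?adj_sym // inE x1 andbT; apply: contra nyx => x0.
  by have /cliqueP-> := maxclique_clique (maxQ ord0).
have [S sS cS] : exists2 S : {set G}, S \subset Q ord0 :&: Q i1 & #|S| = q - t.
  apply: exists_subset_card; rewrite /t; lia.
have letq : t <= q by rewrite /t; lia.
have dAB : [disjoint A & B].
  rewrite disjoint_subset; apply/subsetP=> x /(subsetP sAX); rewrite !inE.
  by move=> /andP[x0 _]; apply: contra x0 => /(subsetP sBY); rewrite inE => /andP[].
have dS_AB : [disjoint S & A :|: B].
  rewrite disjoint_subset; apply/subsetP=> x /(subsetP sS); rewrite !inE.
  move=> /andP[x0 x1]; apply/negP=> /orP[/(subsetP sAX)|/(subsetP sBY)].
    by rewrite inE x0.
  by rewrite inE x1.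
(* [T i] is the part outside [Q i], so that [U :\: T i] lies in [Q i]. *)
pose T (i : 'I_2) := if i == ord0 then A else B.
pose U := S :|: (A :|: B).
have sUQ i : U :\: T i \subset Q i.
  apply/subsetP=> x; have [->|->] := ord2 i; rewrite /T /= !inE => /andP[xT].
    case/orP=> [/(subsetP sS)|]; first by rewrite inE => /andP[].
    by rewrite (negbTE xT) => /(subsetP sBY); rewrite inE => /andP[].
  case/orP=> [/(subsetP sS)|]; first by rewrite inE => /andP[].
  by rewrite (negbTE xT) orbF => /(subsetP sAX); rewrite inE => /andP[].
exists (q - t), U, set0, T; split; first by rewrite /t; lia.
split.
- by rewrite disjoint_sym disjoints_subset sub0set.
- by rewrite /U !cardsU !disjoint_setI0 // !cards0 cS cA cB subKn //; lia.
- split.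
  + move=> i; rewrite /T /U; case: ifP => _; first by rewrite setUCA subsetUl.
    by rewrite setUA subsetUr.
  + by move=> i; rewrite /T subKn //; case: ifP.
  move=> i j; rewrite /T; have [->|->] := ord2 i; have [->|->] := ord2 j => //= _.
  by rewrite disjoint_sym.
left; split=> // i; split; first exact: cliqueS (sUQ i) (maxclique_clique (maxQ i)).
move=> v; rewrite /T; case: ifP => _ vT.
  have [u uB nvu] := covA v vT; apply: (@cliqueN _ _ v u) => //; first exact: setU11.
    by rewrite !inE uB !orbT andbT (disjointFl dAB) ?orbT.
  by apply: contraTneq vT => ->; rewrite (disjointFl dAB).
have [u uA nvu] := covB v vT; apply: (@cliqueN _ _ v u).
- exact: setU11.
- by rewrite !inE uA !orbT andbT (disjointFr dAB) ?orbT.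
- by apply: contraTneq vT => ->; rewrite (disjointFr dAB).
by rewrite adj_sym.
Qed.

(* Each [Q i] is traded for a neighbourhood [A i] of a single vertex [w i] in the
   clique [D], so that [w i] misses a whole private part at once. *)
Lemma obstruction_ocular_p2 (G : sgraph) (p q : nat) :
  1 < p -> 0 < q -> obstruction p q G ->
  exists s (U W : {set G}) T, s < q /\ @ocular_on G p q s U W T.
Proof.
move=> p_gt1 q_gt0 /obstructionP[Q obQ]; pose D := \bigcup_i others Q i.
have maxQ i : Q i \in maxcliques G by have [] := obQ i.
have cQ i := maxclique_clique (maxQ i).
have clD : clique D.
  apply/cliqueP=> x y /bigcupP[i _ /othersP xi] /bigcupP[j _ /othersP yj].
  (* As [p >= 2], there is an index [k] other than [i] and [j], and both vertices lie in the clique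
     [Q k]. *)
  have [|k] := @exists_notin _ [set i; j] _.
    by rewrite card_ord (leq_ltn_trans (leq_card_setU _ _)) // !cards1.
  rewrite !inE negb_or => /andP[ki kj].
  by have /cliqueP := cQ k; apply; [apply: xi|apply: yj].
have sD i : others Q i \subset D by apply: bigcup_sup.
have [v vP] : exists v : 'I_p.+1 -> G, forall i, v i \in others Q i :\: Q i.
  have ex i : exists x, x \in others Q i :\: Q i.
    by have [_ /subsetPn[x xo xi] _] := obQ i; exists x; rewrite inE xi.
  exact: fin_all_exists ex.
have [w wP] : exists w : 'I_p.+1 -> G,
    forall i, [/\ w i \in Q i, v i != w i & ~~ adj (v i) (w i)].
  have ex i : exists y, [/\ y \in Q i, v i != y & ~~ adj (v i) y].
    by apply: maxclique_notin => //; have := vP i; rewrite inE => /andP[].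
  exact: fin_all_exists ex.
pose A i := [set x in D | (x == w i) || adj (w i) x].
have vD i : v i \in D by apply: (subsetP (sD i)); have := vP i; rewrite inE => /andP[].
(* Since [w i] is in [Q i], passing to [A i] loses nothing inside [D], so [others] only grows, while
   [v i] stays outside [A i]. *)
have sQA i : Q i :&: D \subset A i.
  apply/subsetP=> x; rewrite !inE => /andP[xQ ->] /=.
  have [//|/= xw] := eqVneq x (w i); have /cliqueP := cQ i; apply; rewrite 1?eq_sym //.
  by have [] := wP i.
have sub_oth i : others Q i \subset others A i.
  apply/subsetP=> x xo; apply/othersP=> j ji; apply: (subsetP (sQA j)).
  by rewrite inE (subsetP (sD i) _ xo) andbT; apply: (othersP _ _ _ xo).
have nA i : ~~ (others A i \subset A i).
  apply/subsetPn; exists (v i).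
    by apply: (subsetP (sub_oth i)); have := vP i; rewrite inE => /andP[].
  have [_ vw nvw] := wP i.
  by rewrite !inE (negbTE vw) adj_sym (negbTE nvw) andbF.
have leA i : q <= #|others A i|.
  by have [_ _ /leq_trans] := obQ i; apply; apply: subset_leq_card.
have [s [U [T [ltsq cU [sTU cT dT] sU AU]]]] := select_J q_gt0 nA leA.
have sUD : U \subset D.
  have AD i : A i \subset D by apply/subsetP=> x; rewrite inE => /andP[].
  apply: (subset_trans sU); rewrite subUset (subset_trans _ (AD ord0)) ?bigcap_inf //=.
  apply/bigcupsP=> i _; have [j ji] := exists_neq i (ltnW p_gt1).
  by apply: subset_trans (AD j); apply: bigcap_inf.
have wD i : w i \notin D.
  apply/negP=> wi; have [_ vw] := wP i; apply/negP; rewrite negbK.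
  by have /cliqueP := clD; apply.
have T_nadj i x : x \in T i -> (x != w i) && ~~ adj (w i) x.
  move=> xT; have xU := subsetP (sTU i) x xT.
  have /setP/(_ x) := AU i; rewrite !inE xT xU (subsetP sUD x xU) /= andbT.
  by move=> /negbT; rewrite negb_or.
have U_adj i x : x \in U :\: T i -> (x == w i) || adj (w i) x.
  by rewrite -AU !inE => /andP[/andP[]].
(* A vertex of [T i] is missed by [w i], but for [j != i] it lies outside [T j] and is seen by
   [w j]. *)
have injw : injective w.
  move=> i j eqw; apply/eqP; apply: contraT => ij.
  have [x xT] : exists x, x \in T i by apply/card_gt0P; rewrite cT subn_gt0.
  have /andP[xw /negP[]] := T_nadj i x xT.
  have := U_adj j x; rewrite -eqw (negbTE xw); apply.
  by rewrite inE (subsetP (sTU i)) // andbT (disjointFr (dT _ _ ij)).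
exists s, U, [set w i | i : 'I_p.+1], T; split=> //; split=> //.
- rewrite disjoint_sym disjoint_subset; apply/subsetP=> _ /imsetP[i _ ->].
  by rewrite inE; apply: contra (wD i) => /(subsetP sUD).
- by rewrite cU card_ord.
right; split=> //; first exact: cliqueS clD.
exists w; split=> // i; split; apply/forall_inP=> x; rewrite in_setD1 => /andP[xw].
  by move=> /U_adj; rewrite (negbTE xw).
by move=> /T_nadj/andP[].
Qed.

Lemma obstruction_ocular (G : sgraph) (p q : nat) :
  0 < p -> 0 < q -> obstruction p q G ->
  exists s (S : {set G}), s < q /\ ocular (induced S) p q s.
Proof.
move=> p_gt0 q_gt0 ob.
have [s [U [W [T [ltsq oc]]]]] :
    exists s (U W : {set G}) T, s < q /\ @ocular_on G p q s U W T.
  move: p_gt0 ob; rewrite leq_eqVlt => /orP[/eqP<-|]; first exact: obstruction_ocular_p1.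
  by move=> p_gt1; apply: obstruction_ocular_p2.
by exists s, (U :|: W); split=> //; apply: ocular_induced oc.
Qed.

(** * The graph of [q]-cliques *)

Section PhiObstruction.
Variables (p q : nat) (G : sgraph).
Hypotheses (p_gt0 : 0 < p) (q_gt0 : 0 < q).

Lemma Phi_vertex_exists (A : {set G}) x :
  clique A -> x \in A -> q <= #|A| ->
  exists2 B : Phi G q, val B \subset A & x \in val B.
Proof.
move=> cA xA leA; have [|B sB cB] := @exists_subset_card _ (A :\ x) q.-1.
  by move: leA; rewrite (cardsD1 x A) xA; lia.
have xB : x \notin B by apply/negP=> /(subsetP sB); rewrite !inE eqxx.
have sxB : x |: B \subset A.
  by rewrite subUset sub1set xA (subset_trans sB) ?subD1set.
have Px : clique (x |: B) && (#|x |: B| == q).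
  by rewrite (cliqueS sxB cA) cardsU1 xB cB add1n prednK // eqxx.
by exists (exist _ (x |: B) Px) => //=; rewrite setU11.
Qed.

Lemma adj_Phi (A B : Phi G q) (K : {set G}) :
  clique K -> val A \subset K -> val B \subset K -> A != B -> adj A B.
Proof.
move=> cK sA sB AB; rewrite /= /Phi_adj AB; apply/existsP.
by exists K; apply/and3P.
Qed.

Lemma Phi_adjP (A B : Phi G q) :
  adj A B -> exists K : {set G}, [/\ clique K, val A \subset K & val B \subset K].
Proof. by move=> /andP[_ /existsP[K /and3P[]]]; exists K. Qed.

(** From [G], nonadjacent [v] and [w] are put into [q]-cliques [A] and [B], which no clique can
    contain together. Back from [Phi G q], each clique is replaced by the union of its members; a
    single common [A] already supplies [q] vertices. *)
Lemma obstruction_Phi : obstruction p q G <-> obstruction p 1 (Phi G q).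
Proof.
split=> /obstructionP[Q obQ]; last first.
  exists (fun i => \bigcup_(A in Q i) val A) => i.
  have [maxQ /subsetPn[A Ao AQ] _] := obQ i.
  have [B [BQ AB nAB]] := maxclique_notin maxQ AQ.
  have sAo : val A \subset others (fun j => \bigcup_(A in Q j) val A) i.
    apply/subsetP=> x xA; apply/othersP=> j ji; apply/bigcupP; exists A => //.
    exact: (othersP _ _ _ Ao).
  split.
  - apply/cliqueP=> x y /bigcupP[X XQ xX] /bigcupP[Y YQ yY] xy.
    have [eqXY|XY] := eqVneq X Y.
      have /andP[/cliqueP cX _] := valP X.
      by apply: cX => //; rewrite eqXY.
    have /cliqueP/(_ _ _ XQ YQ XY)/Phi_adjP[K [/cliqueP cK sX sY]] := maxclique_clique maxQ.
    by apply: cK; rewrite ?(subsetP sX x xX) ?(subsetP sY y yY).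
  - apply: contra nAB => cl; apply: (adj_Phi cl) => //.
      exact: subset_trans (subsetUr _ _).
    apply: subset_trans (subsetUl _ _); exact: bigcup_sup.
  have /andP[_ /eqP cA] := valP A.
  by rewrite -[X in X <= _]cA subset_leq_card.
exists (fun i => [set A : Phi G q | val A \subset Q i]) => i.
have [maxQ /subsetPn[v vo vQ] leQ] := obQ i.
have [w [wQ vw nvw]] := maxclique_notin maxQ vQ.
have cQ j : clique (Q j) by have [/maxclique_clique] := obQ j.
have [k ki] := exists_neq i p_gt0.
have [A sA vA] : exists2 A : Phi G q, val A \subset others Q i & v \in val A.
  apply: Phi_vertex_exists => //; apply: cliqueS (cQ k); exact: bigcap_inf.
have [B sB wB] : exists2 B : Phi G q, val B \subset Q i & w \in val B.
  (* [Q i] contains [others Q k], so it has at least [q] vertices. *)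
  apply: Phi_vertex_exists => //; have [_ _ /leq_trans] := obQ k; apply.
  by apply: subset_leq_card; apply: bigcap_inf; rewrite eq_sym.
have Ao : A \in others (fun j => [set A : Phi G q | val A \subset Q j]) i.
  apply/othersP=> j ji; rewrite inE (subset_trans sA) //; exact: bigcap_inf.
split; last by apply/card_gt0P; exists A.
  apply/cliqueP=> X Y; rewrite !inE => sX sY; exact: adj_Phi sX sY.
apply: (@cliqueN _ _ A B).
- by rewrite inE Ao orbT.
- by rewrite !inE sB.
- by apply: contraNneq vQ => AB; rewrite (subsetP sB) // -AB.
apply: contra nvw => /Phi_adjP[K [/cliqueP cK sAK sBK]].
by apply: cK; rewrite ?(subsetP sAK v vA) ?(subsetP sBK w wB).
Qed.

End PhiObstruction.

(** * J-configurations *)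

Section Configuration.
Variables (p q : nat) (G : sgraph).
Hypothesis q_gt0 : 0 < q.

Lemma obstruction_J : obstruction p q G ->
  exists s (Q : 'I_p.+1 -> {set G}) (U : {set G}) T,
    [/\ s < q, forall i, Q i \in maxcliques G, #|U| = p.+1 * (q - s) + s,
        disjoint_subsets (q - s) U T & forall i, Q i :&: U = U :\: T i].
Proof.
move=> /obstructionP[Q obQ].
have [||s [U [T [ltsq cU dT _ QU]]]] := @select_J _ _ Q q q_gt0.
- by move=> i; have [] := obQ i.
- by move=> i; have [] := obQ i.
exists s, Q, U, T; split=> //; last by rewrite cU card_ord.
by move=> i; have [] := obQ i.
Qed.

Definition local_condition : Prop := forall s : nat, s < q ->
  forall (U : {set G}) (T : 'I_p.+1 -> {set G}),
    #|U| = p.+1 * (q - s) + s ->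
    disjoint_subsets (q - s) U T ->
    (forall i, clique (U :\: T i)) ->
    exists i : 'I_p.+1, exists2 v : G, v \in T i &
      forall x : G, x != v -> complete x (U :\: T i) -> adj v x.

(** In a J-configuration, [v] in [T i] is outside [Q i] and has a non-neighbour in [Q i], which is
    complete to [U :\: T i]. Conversely, a failure provides [v i] in [T i] and a non-neighbour [w i]
    complete to [U :\: T i]; adjoining [w i] to [U :\: T i] gives the cliques of an obstruction. *)
Lemma local_condition_obstruction : local_condition <-> ~ obstruction p q G.
Proof.
split=> [loc /obstruction_J[s [Q [U [T [ltsq maxQ cU dT QU]]]]]|nob].
  have sUQ i : U :\: T i \subset Q i by rewrite -QU subsetIl.
  have [i|i [v vT vadj]] := loc s ltsq U T cU dT.
    exact: cliqueS (maxclique_clique (maxQ i)).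
  have vQ : v \notin Q i.
    have [sTU _ _] := dT; have /setP/(_ v) := QU i.
    by rewrite !inE vT (subsetP (sTU i)) // andbT => ->.
  have [w [wQ vw /negP[]]] := maxclique_notin (maxQ i) vQ.
  apply: vadj; first by rewrite eq_sym.
  apply/forall_inP=> x; rewrite in_setD1 => /andP[xw /(subsetP (sUQ i)) xQ].
  by have /cliqueP := maxclique_clique (maxQ i); apply; rewrite // eq_sym.
move=> s ltsq U T cU dT clT.
(* A boolean form of the conclusion, whose failure yields witnesses constructively. *)
pose good (i : 'I_p.+1) v := (v \in T i) &&
  [forall x, (x != v) ==> complete x (U :\: T i) ==> adj v x].
have [/existsP[i /existsP[v /andP[vT /forallP vadj]]]|] :=
    boolP [exists i, exists v, good i v].
  exists i, v => // x xv xc; by have := vadj x; rewrite xv xc.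
move=> /existsPn bad; case: nob; have [sTU cT disjT] := dT.
have [v vT] : exists v : 'I_p.+1 -> G, forall i, v i \in T i.
  have ex i : exists x, x \in T i by apply/card_gt0P; rewrite cT subn_gt0.
  exact: fin_all_exists ex.
have [w wP] : exists w : 'I_p.+1 -> G, forall i,
    [/\ w i != v i, complete (w i) (U :\: T i) & ~~ adj (v i) (w i)].
  have ex i : exists x, [/\ x != v i, complete x (U :\: T i) & ~~ adj (v i) x].
    have /existsPn/(_ (v i)) := bad i; rewrite /good vT /= => /forallPn[x].
    by rewrite !negb_imply => /and3P[]; exists x.
  exact: fin_all_exists ex.
exists (fun i => w i |: (U :\: T i)) => i; have [wv wc nvw] := wP i.
have sub j : U :\: T j \subset w j |: (U :\: T j) by apply: subsetUr.
split; first exact: clique_setU1.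
  apply: (@cliqueN _ _ (v i) (w i)); rewrite // 1?eq_sym //.
    rewrite inE; apply/orP; right; apply/othersP=> j ji; apply: (subsetP (sub j)).
    by rewrite inE (subsetP (sTU i)) // (disjointFl (disjT _ _ ji)).
  by rewrite !inE eqxx.
rewrite (leq_trans _ (subset_leq_card (othersS i sub))) //.
by rewrite -(subnK (ltnW ltsq)); apply: card_others_setD; rewrite // cU card_ord.
Qed.

End Configuration.

(** * Submatrices of clique matrices *)

Lemma enum_val_homo (m : nat) (A : {set 'I_m}) :
  {homo (fun i : 'I_#|A| => enum_val i) : i j / i < j}.
Proof.
move=> i j ltij.
(* The values of [enum A] form a subsequence of [0, ..., m - 1]. *)
have sorted_A : sorted ltn (map val (enum A)).
  apply: (subseq_sorted ltn_trans) (iota_ltn_sorted 0 m).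
  by rewrite -val_enum_ord map_subseq // enumT; apply: filter_subseq.
have x0 := enum_val i; rewrite !(enum_val_nth x0).
have /(_ 0 i j) := sorted_ltn_nth ltn_trans _ sorted_A.
rewrite !inE size_map -cardE !ltn_ord => /(_ isT isT ltij).
by rewrite !(nth_map x0) // -cardE.
Qed.

Lemma homo_ltn_inj (m n : nat) (f : 'I_m -> 'I_n) :
  {homo f : i j / i < j} -> injective f.
Proof.
move=> hf i j eqf; apply: val_inj; case: (ltngtP i j) => // /hf;
by rewrite eqf ltnn.
Qed.

Section CliqueMatrix.
Variables (p q : nat) (G : sgraph) (m n : nat) (C : 'M[nat]_(m, n)).
Hypotheses (q_gt0 : 0 < q) (hC : clique_matrix G C).

(** The columns embed the hypergraph's vertices into [G] by [phi], and the row of [~: T i] comes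
    from a maximal clique [Q i] whose preimage under [phi] is [~: T i]. *)
Lemma J_submatrix_obstruction s :
  s < q -> contains_J_submatrix p q s C -> obstruction p q G.
Proof.
move=> ltsq [V [E [m' [n' [M [[cV [T [[_ cT dT] defE]]]]]]]]].
move=> [r' [c' [_ imr' [d c'K dK] eM]]] [f [g [_ hg eqM]]].
have [r [c [_ imr /bij_inj injc eC]]] := hC.
pose phi x := c (g (d x)).
have inj_phi : injective phi.
  by move=> x y /injc/(homo_ltn_inj hg)/(can_inj dK).
have [k kP] : exists k : 'I_p.+1 -> 'I_m', forall i, r' (k i) = ~: T i.
  have ex i : exists k, r' k = ~: T i.
    have : ~: T i \in [set r' k | k : 'I_m'] by rewrite imr' defE; apply/imsetP; exists i.
    by case/imsetP=> k _ ->; exists k.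
  exact: fin_all_exists ex.
pose Q i := r (f (k i)).
have phiQ x i : (phi x \in Q i) = (x \notin T i).
  have := eM (k i) (d x); rewrite eqM mxE eC dK kP inE.
  by rewrite -/(phi x) -/(Q i); case: (phi x \in Q i); case: (x \notin T i).
apply/obstructionP; exists Q => i; split.
- by rewrite -imr /Q imset_f.
- have [x xT] : exists x, x \in T i by apply/card_gt0P; rewrite cT subn_gt0.
  apply/subsetPn; exists (phi x); last by rewrite phiQ xT.
  by apply/othersP=> j ji; rewrite phiQ (disjointFl (dT _ _ ji)).
apply: (@leq_trans #|others (fun j => [set: V] :\: T j) i|).
  rewrite -{1}(subnK (ltnW ltsq)); apply: card_others_setD => //.
  by rewrite cardsT cV card_ord.
rewrite -(card_imset _ inj_phi) subset_leq_card //.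
apply/subsetP=> _ /imsetP[x /othersP xo ->]; apply/othersP=> j ji.
by rewrite phiQ; have := xo j ji; rewrite !inE andbT.
Qed.

(** Keep the rows of the [Q i] and the columns of [U], in increasing order. The kept column indices
    themselves serve as hypergraph vertices. *)
Lemma obstruction_J_submatrix :
  obstruction p q G -> exists2 s, s < q & contains_J_submatrix p q s C.
Proof.
move=> /(obstruction_J q_gt0)[s [Q [U [T [ltsq maxQ cU [sTU cT dT] QU]]]]].
have [r [c [injr imr bijc eC]]] := hC; have injc := bij_inj bijc.
exists s => //; pose R := [set k | r k \in [set Q i | i : 'I_p.+1]].
pose J := [set j | c j \in U].
pose f (k : 'I_#|R|) : 'I_m := enum_val k.
pose g (j : 'I_#|J|) : 'I_n := enum_val j.
pose phi j := c (g j).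
have inj_phi : injective phi by move=> i j /injc/enum_val_inj.
have phiU j : phi j \in U by have := enum_valP j; rewrite inE.
have imphi (A : {set G}) : A \subset U -> phi @: (phi @^-1: A) = A.
  move=> sAU; apply/setP=> x; apply/imsetP/idP => [[j]|xA].
    by rewrite inE => jA ->.
  have [d cK dK] := bijc; have dJ : d x \in J by rewrite inE dK (subsetP sAU).
  exists (enum_rank_in dJ (d x)); first by rewrite inE /phi /g enum_rankK_in ?dK.
  by rewrite /phi /g enum_rankK_in // dK.
have card_phi (A : {set G}) : A \subset U -> #|phi @^-1: A| = #|A|.
  by move=> sAU; rewrite -(card_imset _ inj_phi) imphi.
pose T' i := phi @^-1: T i.
pose r' (k : 'I_#|R|) := phi @^-1: r (f k).
have r'E k i : r (f k) = Q i -> r' k = ~: T' i.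
  move=> eqQ; apply/setP=> j; rewrite !inE eqQ; have /setP/(_ (phi j)) := QU i.
  by rewrite !inE phiU !andbT.
have fR k : exists i, r (f k) = Q i.
  by have := enum_valP k; rewrite inE => /imsetP[i _ eqQ]; exists i.
(* As [s < q], the [T' i] are nonempty, so being disjoint they differ; this makes the rows
   distinct. *)
have injT' : injective T'.
  move=> i j eqT; apply/eqP; apply: contraT => ij.
  have [x xT] : exists x, x \in T' i.
    by apply/card_gt0P; rewrite card_phi // cT subn_gt0.
  have xTj : x \in T' j by rewrite -eqT.
  by move: xT xTj; rewrite !inE => xT; rewrite (disjointFr (dT _ _ ij)).
exists 'I_#|J|, [set ~: T' i | i : 'I_p.+1], #|R|, #|J|, (mxsub f g C); split.
- split.
    rewrite -cU -(card_phi U) //; apply: eq_card => j.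
    by rewrite !inE phiU.
  exists T'; split=> //; split=> [i|i|i j ij]; first exact: subsetT.
    by rewrite card_phi.
  by rewrite -setI_eq0 -preimsetI disjoint_setI0 ?preimset0 ?eqxx ?dT.
- exists r', id; split.
  + move=> k l; have [[i ki] [j lj]] := (fR k, fR l).
    rewrite (r'E k i) // (r'E l j) // => /setC_inj/injT' eqij.
    by apply: enum_val_inj; apply: injr; rewrite ki lj eqij.
  + apply/setP=> A; apply/imsetP/imsetP => -[k _ ->].
      by have [i ki] := fR k; exists i; rewrite ?(r'E k i).
    have : Q k \in [set r l | l : 'I_m] by rewrite imr.
    case/imsetP=> l _ eql; have lR : l \in R by rewrite inE -eql imset_f.
    exists (enum_rank_in lR l) => //; apply/esym/r'E.
    by rewrite /f enum_rankK_in.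
  + by exists id.
  by move=> k j; rewrite mxE eC inE.
by exists f, g; split=> //; apply: enum_val_homo.
Qed.

End CliqueMatrix.

(** * Assembling the equivalences *)

Lemma no_obstruction_strong (p q : nat) (G : sgraph) :
  0 < p -> ~ obstruction p q G -> strong_clique_helly G p q.
Proof.
move=> p_gt0 nob; apply: no_obstruction_strong_helly => // Q obQ.
by apply: nob; apply/obstructionP; exists Q.
Qed.

(** A (p,q')-intersecting family is also (p,q)-intersecting; its at most [p] members with the same
    core have a core of size at least [q']. *)
Lemma strong_helly_helly (V : finType) (p q q' : nat) (F : {set {set V}}) :
  0 < p -> q <= q' -> strong_helly p q F -> helly p q' F.
Proof.
move=> p_gt0 leq sh F' sF ne int.
have int' : intersecting p q F' by move=> F0 s0 ne0 /(int _ s0 ne0); apply: leq_trans.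
by have [F0 [sF0 ne0 cF0 <-]] := sh F' sF ne int'; apply: int.
Qed.

(** An obstruction produces an induced ocular, which is not clique-Helly; conversely, an obstruction
    in an induced subgraph passes to [G]. *)
Lemma hereditary_obstruction (p q : nat) (G : sgraph) :
  0 < p -> 0 < q -> hereditary_clique_helly G p q <-> ~ obstruction p q G.
Proof.
move=> p_gt0 q_gt0; split=> [her|nob S].
  move=> /(obstruction_ocular p_gt0 q_gt0)[s [S [ltsq oc]]].
  exact: ocular_not_helly ltsq oc (her S).
apply: strong_helly_helly (leqnn q) _ => //; apply: no_obstruction_strong => //.
by move=> /obstruction_induced.
Qed.

Theorem theorem3p12 (p q : nat) (hp : 0 < p) (hq : 0 < q) (G : sgraph)
    (m n : nat) (C : 'M[nat]_(m, n)) (hC : clique_matrix G C) :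
  [<-> hereditary_clique_helly G p q;
       forall q' : nat, q <= q' -> clique_helly G p q';
       strong_clique_helly G p q;
       forall F : {set {set G}}, F \subset maxcliques G -> #|F| = p.+1 ->
         strong_helly p q F;
       hereditary_clique_helly (Phi G q) p 1;
       forall s : nat, s < q -> ~ contains_J_submatrix p q s C;
       forall s : nat, s < q ->
         forall (U : {set G}) (T : 'I_p.+1 -> {set G}),
           #|U| = p.+1 * (q - s) + s ->
           disjoint_subsets (q - s) U T ->
           (forall i, clique (U :\: T i)) ->
           exists i : 'I_p.+1, exists2 v : G, v \in T i &
             forall x : G, x != v -> complete x (U :\: T i) -> adj v x;
       forall s : nat, s < q -> ~ contains_induced_ocular G p q s].
Proof.
have loc := local_condition_obstruction p G hq.
have her := hereditary_obstruction G hp hq.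
have herPhi := hereditary_obstruction (Phi G q) hp (ltn0Sn 0).
have obPhi := obstruction_Phi G hp hq.
(* The implications run cyclically; all but the third, a mere restriction to subfamilies, go through
   [obstruction]. *)
tfae.
- move=> /her/(no_obstruction_strong hp) sh q' leq.
  exact: strong_helly_helly sh.
- move=> h; apply: no_obstruction_strong => // /obstructionP[Q obQ].
  have [i|i|i|q' leq nh] := @not_helly_some _ _ Q q (maxcliques G);
    try by have [] := obQ i.
  exact: nh (h q' leq).
- by move=> sh F sF _ F' sF'; apply: sh; apply: subset_trans sF.
- move=> h; apply/herPhi => /obPhi/obstructionP[Q obQ].
  have nQ i : ~~ (others Q i \subset Q i) by have [] := obQ i.
  apply: (not_strong_helly_imset nQ) (h _ _ _) => [i||].
  - by have [] := obQ i.
  - by apply/subsetP=> _ /imsetP[i _ ->]; have [] := obQ i.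
  by rewrite (card_imset _ (others_inj nQ)) card_ord.
- move=> /herPhi nob s ltsq /(J_submatrix_obstruction hC ltsq) ob.
  by apply: nob; apply/obPhi.
- move=> noJ; apply/loc => /(obstruction_J_submatrix hq hC)[s ltsq].
  exact: noJ.
- move=> /loc nob s ltsq [H [S [oc [f [[h fK hK] adjf]]]]]; apply: nob.
  (* The inverse isomorphism followed by [val] embeds the ocular into [G]. *)
  apply: (@obstruction_embed _ _ G H (fun x => val (h x))).
  - by move=> x y /val_inj/(can_inj hK).
  - by move=> x y; rewrite -{2}(hK x) -{2}(hK y) adjf.
  exact: ocular_obstruction oc.
move=> nooc; apply/her => /(obstruction_ocular hp hq)[s [S [ltsq oc]]].
apply: (nooc s ltsq); exists (induced S), S; split=> //.
by exists id; split=> //; exists id.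
Qed.
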